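(* Let $(X,\mathsf{d},\mathfrak m)$ be a metric measure space, let $p\ge 1$, and let $(\rho_n)_{n\in\mathbb N}$ be a sequence of non-negative, symmetric, measurable functions defined on $\{(x,y)\in X\times X: x\neq y\}$ satisfying conditions (A), (B), (C) below. For $u\in L^p(X,\mathfrak m)$ and $n\in\mathbb N$ set \[ \mathcal E_n(u):=\iint_{\{(x,y)\in X\times X:\,x\neq y\}}|u(x)-u(y)|^p\,\rho_n(x,y)\,\mathrm d\mathfrak m(x)\,\mathrm d\mathfrak m(y). \] The conditions are: (A) there is a constant $L\ge 0$ such that for every $x\in X$ \[ \lim_{R\to+\infty}\limsup_{n\to\infty}\int_{B^c_R(x)}\rho_n(x,y)\,\mathrm d\mathfrak m(y)=\lim_{R\to+\infty}\liminf_{n\to\infty}\int_{B^c_R(x)}\rho_n(x,y)\,\mathrm d\mathfrak m(y)=L, \] where $B^c_R(x)=\{y\in X:\mathsf d(x,y)\ge R\}$; (B) for every $u\in L^p(X,\mathfrak m)$ for which there exists $n_0\in\mathbb N$ with $\mathcal E_{n_0}(u)<+\infty$, one has for every $R>0$ \[ \lim_{n\to\infty}\iint_{\{(x,y):\,0<\mathsf d(x,y)<R\}}|u(x)-u(y)|^p\rho_n(x,y)\,\mathrm d\mathfrak m(x)\,\mathrm d\mathfrak m(y)=0; \] (C) for every sufficiently large $R>0$ there is a constant $C=C(R)$ such that $\int_{B^c_R(x)}\rho_n(x,y)\,\mathrm d\mathfrak m(y)\le C$ for all $x\in X$ and all $n\in\mathbb N$. Then for every $u\in L^p(X,\mathfrak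 m)$ such that $\mathcal E_{n_0}(u)<+\infty$ for some $n_0\in\mathbb N$, it holds \[ \lim_{n\to\infty}\mathcal E_n(u)=2L\,\|u\|^p_{L^p}. \]
   Context: A metric measure space is a triple $(X,\mathsf d,\mathfrak m)$ where $(X,\mathsf d)$ is a complete separable metric space and $\mathfrak m$ is a locally finite non-negative Borel measure on $X$ with full support. *)

(* Defs.v *)
From HB Require Import structures.
From mathcomp Require Import all_boot all_order all_algebra.
From mathcomp Require Import all_classical all_reals all_analysis.
Set Implicit Arguments. Unset Strict Implicit. Unset Printing Implicit Defensive.
Import Order.TTheory GRing.Theory Num.Theory.
Local Open Scope classical_set_scope.
Local Open Scope ring_scope.

Definition is_metric (R : realType) (X : Type) (dist : X -> X -> R) : Prop :=
  [/\ forall x y, 0 <= dist x y,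
      forall x y, dist x y = 0 <-> x = y,
      forall x y, dist x y = dist y x &
      forall x y z, dist x z <= dist x y + dist y z].

Definition dopen (R : realType) (X : Type) (dist : X -> X -> R) (A : set X) : Prop :=
  forall x, A x -> exists2 e : R, 0 < e & [set y | dist x y < e] `<=` A.

Definition dcomplete (R : realType) (X : Type) (dist : X -> X -> R) : Prop :=
  forall u : nat -> X,
    (forall e : R, 0 < e -> exists N : nat, forall m n, (N <= m)%N -> (N <= n)%N ->
        dist (u m) (u n) < e) ->
    exists l : X, forall e : R, 0 < e -> exists N : nat, forall n, (N <= n)%N ->
        dist (u n) l < e.

Definition dseparable (R : realType) (X : Type) (dist : X -> X -> R) : Prop :=
  exists s : nat -> X, forall x (e : R), 0 < e -> exists n, dist x (s n) < e.

Definition metric_measure_space (R : realType) (d : measure_display)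
  (X : measurableType d) (dist : X -> X -> R) (mu : {measure set X -> \bar R}) : Prop :=
  [/\ is_metric dist, dcomplete dist, dseparable dist &
      (@measurable d X : set (set X)) = <<s dopen dist >>] /\
  (forall x, exists2 e : R, 0 < e & (mu [set y | (dist x y < e)%R] < +oo)%E) /\
  (forall x (e : R), 0 < e -> (0 < mu [set y | (dist x y < e)%R])%E).

Definition in_Lp (R : realType) (d : measure_display) (X : measurableType d)
  (mu : {measure set X -> \bar R}) (p : R) (u : X -> R) : Prop :=
  measurable_fun setT u /\ (\int[mu]_x (`|u x| `^ p)%:E < +oo)%E.

Definition Lp_norm_pow (R : realType) (d : measure_display) (X : measurableType d)
  (mu : {measure set X -> \bar R}) (p : R) (u : X -> R) : \bar R :=
  (\int[mu]_x (`|u x| `^ p)%:E)%E.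

Definition energy_on (R : realType) (d : measure_display) (X : measurableType d)
  (mu : {measure set X -> \bar R}) (p : R) (D : X -> set X) (rho : X -> X -> R)
  (u : X -> R) : \bar R :=
  (\int[mu]_x \int[mu]_(y in D x) ((`|u x - u y| `^ p) * rho x y)%:E)%E.

Definition energy (R : realType) (d : measure_display) (X : measurableType d)
  (mu : {measure set X -> \bar R}) (p : R) (rho : X -> X -> R) (u : X -> R) : \bar R :=
  energy_on mu p (fun x => [set y | y <> x]) rho u.

Definition tail_int (R : realType) (d : measure_display) (X : measurableType d)
  (dist : X -> X -> R) (mu : {measure set X -> \bar R}) (rho : X -> X -> R)
  (x : X) (r : R) : \bar R :=
  (\int[mu]_(y in [set y | (r <= dist x y)%R]) (rho x y)%:E)%E.

(* Main.v *)
(* The energy at distance less than [r] vanishes by (B). At distance at least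
   [r], with [r] large, [u x] and [u y] cannot both be relevant since [|u|^p] has
   little mass outside a large ball, so [|u x - u y|^p] is close to
   [|u x|^p + |u y|^p], uniformly in [n] by (C). By Tonelli and the symmetry of
   [rho n], the integral of the latter is twice that of [|u|^p] against the tail
   integral of [rho n], and dominated convergence, first in [n] and then in [r],
   concludes by (A). *)
Require Import Defs.
From HB Require Import structures.
From mathcomp Require Import all_boot all_order all_algebra.
From mathcomp Require Import all_classical all_reals all_analysis.
From mathcomp Require Import measurable_realfun ring lra.
Import Order.TTheory GRing.Theory Num.Theory.
Local Open Scope classical_set_scope.
Local Open Scope ring_scope.

Set Implicit Arguments.
Unset Strict Implicit.

(** Condition (A) does not say that the tail mass at a fixed radius converges in [n]: only its
    limsup and liminf are controlled, and only once the radius tends to infinity. Dominated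
    convergence is therefore applied to the envelopes [esups] and [einfs] of the tail masses, which
    do converge in [n] and enclose them; (C) bounds them all by one constant, so a multiple of
    [|u|^p] dominates. The order of choices is what makes the argument close. The far estimate is
    proved for every symmetric kernel of mass at most a given constant that lives at distance at
    least [r], with [r] depending only on [u], [p], that constant and the tolerance. A radius can
    thus be fixed first, good for all [n], and (B) is then used at that radius while [n] grows. The
    interaction of [u x] and [u y] is measured by [min (|u x|^p) (|u y|^p)]. For distant points it
    is at most [w x + w y], with [w] the function [|u|^p] cut off to the outside of a large ball, so
    its integral against the kernel is at most a constant times the small integral of [w]. *)

(** * Sigma-finiteness and measurability drawn from the metric *)

Lemma mms_measurable_ball (R : realType) (d : measure_display)
    (X : measurableType d) (dist : X -> X -> R) (mu : {measure set X -> \bar R}) :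
  metric_measure_space dist mu ->
  forall x (e : R), measurable [set y | dist x y < e].
Proof.
move=> [[[d0 deq dC dtri] _ _ ->] _] x e; apply: sub_sigma_algebra => y /= xye.
exists (e - dist x y); first by rewrite subr_gt0.
move=> z /= yz; apply: le_lt_trans (dtri x y z) _.
by rewrite -ltrBrDl.
Qed.

(** Tonelli requires this. Balls of radius [1/(j+1)] around the dense sequence form a countable
    family; those of finite measure still cover, by local finiteness. *)
Lemma mms_sigma_finite (R : realType) (d : measure_display)
    (X : measurableType d) (dist : X -> X -> R) (mu : {measure set X -> \bar R}) :
  metric_measure_space dist mu -> sigma_finite setT mu.
Proof.
move=> mms; have mball := mms_measurable_ball mms.
case: mms => [[[d0 deq dC dtri] _ [s ds] _] [lf _]].
pose B (ij : nat * nat) : set X := [set y | dist (s ij.1) y < ij.2.+1%:R^-1].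
pose F k : set X := if unpickle k is Some ij then
  (if `[< (mu (B ij) < +oo)%E >] then B ij else set0) else set0.
exists F; last first.
  move=> k; rewrite /F; case: (unpickle k) => [ij|]; last by rewrite measure0.
  case: asboolP => [h|_]; last by rewrite measure0.
  by split => //; exact: mball.
rewrite predeqE => x; split => // _.
have [e e0 xe] := lf x.
(* Half of [e]: the ball around [s i] must contain [x] and stay inside the finite-measure ball of
   radius [e] around [x]. *)
have [j je] : exists j : nat, j.+1%:R^-1 < e / 2.
  have e20 : 0 < e / 2 by rewrite divr_gt0.
  exists (Num.truncn (e / 2)^-1); rewrite invf_plt ?posrE// ?truncnS_gt//.
have [i xi] := ds x j.+1%:R^-1 (ltac:(by rewrite invr_gt0)).
exists (pickle (i, j)) => //; rewrite /F pickleK.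
case: asboolP => [_|]; first by rewrite /B/= dC.
case; apply: le_lt_trans xe; apply: le_measure; rewrite ?inE; try exact: mball.
move=> y /= iy; apply: le_lt_trans (dtri x (s i) y) _.
rewrite (splitr e) ltrD//; exact: lt_trans je.
Qed.

(** Measurability is with respect to the product sigma-algebra, so continuity alone does not give
    it; separability writes each sublevel set as a countable union of products of balls. *)
Lemma mms_measurable_dist (R : realType) (d : measure_display)
    (X : measurableType d) (dist : X -> X -> R) (mu : {measure set X -> \bar R}) :
  metric_measure_space dist mu ->
  measurable_fun setT (fun z : X * X => dist z.1 z.2).
Proof.
move=> mms; have mball := mms_measurable_ball mms.
case: mms => [[[d0 deq dC dtri] _ [s ds] _] _].
move=> mT; apply: (measurability _ (RGenInftyO.measurableE R)) => //.
move=> _ [_ [e ->] <-]; rewrite setTI.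
rewrite [X in measurable X](_ : _ = \bigcup_i \bigcup_j
  ([set x | dist (s i) x < j.+1%:R^-1] `*` [set y | dist (s i) y < e - j.+1%:R^-1])).
  apply: bigcup_measurable => i _; apply: bigcup_measurable => j _.
  by apply: measurableX.
rewrite predeqE => -[x y]; rewrite /= in_itv/=; split => [xye|].
  have d20 : 0 < (e - dist x y) / 2 by rewrite divr_gt0// subr_gt0.
  pose j := Num.truncn ((e - dist x y) / 2)^-1.
  have je : j.+1%:R^-1 < (e - dist x y) / 2.
    by rewrite invf_plt ?posrE// ?truncnS_gt.
  have [i xi] := ds x j.+1%:R^-1 (ltac:(by rewrite invr_gt0)).
  exists i => //; exists j => //; split => /=; first by rewrite dC.
  have := dtri (s i) x y; rewrite (dC _ x).
  move: xi je; move: (_.+1%:R^-1) => c; lra.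
move=> [i _ [j _ []]] /=; have := dtri x (s i) y; rewrite (dC x (s i)).
move: (_.+1%:R^-1) => c; lra.
Qed.

Lemma mms_measurable_dist_itv (R : realType) (d : measure_display)
    (X : measurableType d) (dist : X -> X -> R) (mu : {measure set X -> \bar R})
    (i : interval R) :
  metric_measure_space dist mu -> measurable [set z : X * X | dist z.1 z.2 \in i].
Proof.
move=> /mms_measurable_dist mdist; rewrite -[X in measurable X]setTI.
exact: (mdist measurableT _ (measurable_itv i)).
Qed.

Lemma mms_measurable_far (R : realType) (d : measure_display)
    (X : measurableType d) (dist : X -> X -> R) (mu : {measure set X -> \bar R})
    (r : R) :
  metric_measure_space dist mu -> measurable [set z : X * X | r <= dist z.1 z.2].
Proof.
move=> /(mms_measurable_dist_itv `[r, +oo[).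
by congr measurable; apply/seteqP; split => z /=; rewrite in_itv/= andbT.
Qed.

Lemma mms_dist_gt0 (R : realType) (d : measure_display)
    (X : measurableType d) (dist : X -> X -> R) (mu : {measure set X -> \bar R}) :
  metric_measure_space dist mu -> forall x y, x <> y <-> 0 < dist x y.
Proof.
move=> [[[d0 deq _ _] _ _ _] _] x y; rewrite lt_def d0 andbT.
by split=> [xy|/eqP xy]; [apply/eqP => /deq | move=> /deq].
Qed.

Lemma mms_measurable_offdiag (R : realType) (d : measure_display)
    (X : measurableType d) (dist : X -> X -> R) (mu : {measure set X -> \bar R}) :
  metric_measure_space dist mu -> measurable [set z : X * X | z.1 <> z.2].
Proof.
move=> mms; have := mms_measurable_dist_itv `]0, +oo[ mms.
congr measurable; apply/seteqP; split => z /=; rewrite in_itv/= andbT.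
  by move=> /(mms_dist_gt0 mms).
by move=> /(mms_dist_gt0 mms).
Qed.

(** * The elementary inequality for [|a - b|^p] *)

Lemma powR_sub_close_half (R : realType) (p e : R) : 0 < p -> 0 < e < 1 ->
  exists2 C : R, 0 <= C & forall a b : R, `|b| <= `|a| ->
    `|a - b| `^ p <= (1 + e) * (`|a| `^ p + `|b| `^ p) + C * `|b| `^ p /\
    (1 - e) * (`|a| `^ p + `|b| `^ p) <= `|a - b| `^ p + C * `|b| `^ p.
Proof.
move=> p0 /andP[e0 e1].
have pV (t : R) : 0 <= t -> (t `^ p^-1) `^ p = t.
  by move=> t0; rewrite -powRrM mulVf ?gt_eqF// powRr1.
have lt_powV (x y : R) : 0 <= x -> x < y -> x `^ p^-1 < y `^ p^-1.
  by move=> x0 xy; apply: gt0_ltr_powR; rewrite ?nnegrE ?invr_gt0//; lra.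
have le_pow (x y : R) : 0 <= x -> x <= y -> x `^ p <= y `^ p.
  by move=> x0 xy; apply: ge0_ler_powR; rewrite ?nnegrE//; lra.
have [dl [dl0 dl1 [h1 h2 h3]]] : exists dl : R, [/\ 0 < dl, dl <= 1 &
    [/\ (1 + dl) `^ p <= 1 + e, 1 - e / 2 <= (1 - dl) `^ p & dl `^ p <= e / 2]].
  have x1 : 1 < (1 + e) `^ p^-1.
    have := lt_powV 1 (1 + e); rewrite powR1; apply; lra.
  have x2 : (1 - e / 2) `^ p^-1 < 1.
    have := lt_powV (1 - e / 2) 1; rewrite powR1; apply; lra.
  have x3 : 0 < (e / 2) `^ p^-1 by rewrite powR_gt0// divr_gt0.
  have x20 : 0 <= (1 - e / 2) `^ p^-1 by rewrite powR_ge0.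
  (* Each of the three requirements on [dl] is solved explicitly by a [p]-th root. The halves of [e]
     come from [(1 - e) * (1 + e / 2) <= 1 - e / 2], used in the lower bound. *)
  pose dl := Num.min ((1 + e) `^ p^-1 - 1)
              (Num.min (1 - (1 - e / 2) `^ p^-1) ((e / 2) `^ p^-1)).
  have dl0 : 0 < dl by rewrite /dl !lt_min x3 !subr_gt0 x1 x2.
  have y1 : dl <= (1 + e) `^ p^-1 - 1 by rewrite /dl ge_min lexx.
  have y2 : dl <= 1 - (1 - e / 2) `^ p^-1 by rewrite /dl !ge_min lexx !orbT.
  have y3 : dl <= (e / 2) `^ p^-1 by rewrite /dl !ge_min lexx !orbT.
  exists dl; split => //; first by lra.
  split.
  - rewrite -[leRHS]pV; last by lra.
    by apply: le_pow; lra.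
  - rewrite -[leLHS]pV; last by lra.
    by apply: le_pow; lra.
  - rewrite -[leRHS]pV; last by lra.
    by apply: le_pow; lra.
have q0 : 0 < dl `^ p by rewrite powR_gt0.
(* For comparable values, [2^p] pays for [|a - b|^p <= 2^p |a|^p] in the upper bound and [2] for
   [|a|^p + |b|^p <= 2 |a|^p] in the lower one. *)
exists ((2 `^ p + 2) / dl `^ p); first by rewrite divr_ge0 ?addr_ge0 ?powR_ge0.
move=> a b ba; have A0 := powR_ge0 `|a| p; have B0 := powR_ge0 `|b| p.
have na := normr_ge0 a; have nb := normr_ge0 b; have nab := normr_ge0 (a - b).
have D0 := powR_ge0 `|a - b| p; have T0 := powR_ge0 2 p.
have [ba'|ab'] := leP `|b| (dl * `|a|).
  have C0 : 0 <= (2 `^ p + 2) / dl `^ p * `|b| `^ p.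
    by rewrite mulr_ge0// divr_ge0 ?addr_ge0 ?powR_ge0.
  have up : `|a - b| `^ p <= (1 + e) * `|a| `^ p.
    apply: (@le_trans _ _ ((1 + dl) `^ p * `|a| `^ p)).
      rewrite -powRM//; last by lra.
      apply: le_pow; first nra.
      by apply: le_trans (ler_normB _ _) _; lra.
    by rewrite ler_wpM2r.
  have lo : (1 - e / 2) * `|a| `^ p <= `|a - b| `^ p.
    apply: (@le_trans _ _ ((1 - dl) `^ p * `|a| `^ p)).
      by rewrite ler_wpM2r.
    rewrite -powRM//; last by lra.
    apply: le_pow; first nra.
    by have := lerB_dist a b; lra.
  have bs : `|b| `^ p <= e / 2 * `|a| `^ p.
    apply: (@le_trans _ _ (dl `^ p * `|a| `^ p)).
      rewrite -powRM//; last by lra.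
      by apply: le_pow; [nra|].
    by rewrite ler_wpM2r.
  split; nra.
have Ab : `|a| `^ p <= `|b| `^ p / dl `^ p.
  rewrite ler_pdivlMr// mulrC -powRM//; last by lra.
  by apply: le_pow; [nra|lra].
have up : `|a - b| `^ p <= 2 `^ p * `|a| `^ p.
  rewrite -powRM//; apply: le_pow => //.
  by apply: le_trans (ler_normB _ _) _; lra.
have BA : `|b| `^ p <= `|a| `^ p by exact: le_pow.
have E : (2 `^ p + 2) / dl `^ p * `|b| `^ p = (2 `^ p + 2) * (`|b| `^ p / dl `^ p).
  by rewrite -mulrA (mulrC _^-1).
rewrite E.
have ? : 0 <= `|b| `^ p / dl `^ p by exact: le_trans Ab.
split; nra.
Qed.

(* [|a - b|^p] is close to [|a|^p + |b|^p] when one value is much smaller than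
   the other; the [Num.min] term absorbs the interaction of comparable values. *)
Lemma powR_sub_close (R : realType) (p e : R) : 0 < p -> 0 < e < 1 ->
  exists2 C : R, 0 <= C & forall a b : R,
    `|a - b| `^ p <= (1 + e) * (`|a| `^ p + `|b| `^ p) +
                     C * Num.min (`|a| `^ p) (`|b| `^ p) /\
    (1 - e) * (`|a| `^ p + `|b| `^ p) <=
      `|a - b| `^ p + C * Num.min (`|a| `^ p) (`|b| `^ p).
Proof.
move=> p0 e01; have [C C0 HC] := powR_sub_close_half p0 e01.
exists C => // a b; have [ab|ba] := leP `|a| `|b|.
  have -> : Num.min (`|a| `^ p) (`|b| `^ p) = `|a| `^ p.
    by apply/min_idPl; apply: ge0_ler_powR; rewrite ?nnegrE// ltW.
  by rewrite distrC (addrC (`|a| `^ p)); exact: HC.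
have -> : Num.min (`|a| `^ p) (`|b| `^ p) = `|b| `^ p.
  by apply/min_idPr; apply: ge0_ler_powR; rewrite ?nnegrE// ltW.
by apply: HC; exact: ltW.
Qed.

(** * Energies and masses of a symmetric kernel *)

Lemma measurable_norm_powR (R : realType) (d : measure_display)
    (X : measurableType d) (p : R) (u : X -> R) :
  measurable_fun setT u -> measurable_fun setT (fun x => `|u x| `^ p).
Proof.
by move=> ?; apply: (measurableT_comp (measurable_powR p)); apply: measurableT_comp.
Qed.

Lemma measurable_energy_integrand (R : realType) (d : measure_display)
    (X : measurableType d) (p : R) (u : X -> R) (k : X * X -> R) :
  measurable_fun setT u -> measurable_fun setT k ->
  measurable_fun setT (fun z : X * X => `|u z.1 - u z.2| `^ p * k z).
Proof.
move=> ? ?; apply: measurable_funM => //; apply: measurable_norm_powR.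
by apply: measurable_funB; exact: measurableT_comp.
Qed.

Lemma integral_kernel_fst (R : realType) (d : measure_display)
    (X : measurableType d) (mu : {sigma_finite_measure set X -> \bar R})
    (k : X * X -> R) (g : X -> R) :
  measurable_fun setT k -> (forall z, 0 <= k z) ->
  measurable_fun setT g -> (forall x, 0 <= g x) ->
  (\int[mu \x mu]_z (g z.1 * k z)%:E =
   \int[mu]_x ((g x)%:E * \int[mu]_y (k (x, y))%:E))%E.
Proof.
move=> mk k0 mg g0; rewrite fubini_tonelli1; last 2 first.
- apply/measurable_EFinP; apply: measurable_funM => //.
  exact: measurableT_comp.
- by move=> z; rewrite lee_fin mulr_ge0.
apply: eq_integral => x _; rewrite /fubini_F/=.
under eq_integral do rewrite EFinM.
rewrite ge0_integralZl ?lee_fin//.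
- by apply/measurable_EFinP; apply: measurableT_comp.
- by move=> y _; rewrite lee_fin.
Qed.

(** Integrating out the first coordinate leaves the mass of [k (y, x)] in [y], which symmetry turns
    into that of [k (x, y)]. This second copy of the same integral is the origin of the factor 2. *)
Lemma integral_kernel_snd (R : realType) (d : measure_display)
    (X : measurableType d) (mu : {sigma_finite_measure set X -> \bar R})
    (k : X * X -> R) (g : X -> R) :
  measurable_fun setT k -> (forall z, 0 <= k z) ->
  (forall x y, k (x, y) = k (y, x)) ->
  measurable_fun setT g -> (forall x, 0 <= g x) ->
  (\int[mu \x mu]_z (g z.2 * k z)%:E =
   \int[mu]_x ((g x)%:E * \int[mu]_y (k (x, y))%:E))%E.
Proof.
move=> mk k0 ksym mg g0; rewrite fubini_tonelli2; last 2 first.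
- apply/measurable_EFinP; apply: measurable_funM => //.
  exact: measurableT_comp.
- by move=> z; rewrite lee_fin mulr_ge0.
apply: eq_integral => x _; rewrite /fubini_G/=.
under eq_integral do rewrite ksym EFinM.
rewrite ge0_integralZl ?lee_fin//.
- by apply/measurable_EFinP; apply: measurableT_comp.
- by move=> y _; rewrite lee_fin.
Qed.

Lemma measurable_kernel_mass (R : realType) (d : measure_display)
    (X : measurableType d) (mu : {sigma_finite_measure set X -> \bar R})
    (k : X * X -> R) :
  measurable_fun setT k -> (forall z, 0 <= k z) ->
  measurable_fun setT (fun x => \int[mu]_y (k (x, y))%:E)%E.
Proof.
move=> mk k0; apply: (measurable_fun_fubini_tonelli_F (EFin \o k)) => //.
  exact/measurable_EFinP.
Qed.

(** The pointwise inequality integrated against [k], with [w] as a majorant of the interaction term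
    on the support of [k]. *)
Lemma kernel_energy_close (R : realType) (d : measure_display)
    (X : measurableType d) (mu : {sigma_finite_measure set X -> \bar R})
    (p e C : R) (k : X * X -> R) (u w : X -> R) :
  0 < p -> 0 < e < 1 -> 0 <= C ->
  (forall a b : R,
    `|a - b| `^ p <= (1 + e) * (`|a| `^ p + `|b| `^ p) +
                     C * Num.min (`|a| `^ p) (`|b| `^ p) /\
    (1 - e) * (`|a| `^ p + `|b| `^ p) <=
      `|a - b| `^ p + C * Num.min (`|a| `^ p) (`|b| `^ p)) ->
  measurable_fun setT k -> (forall z, 0 <= k z) ->
  (forall x y, k (x, y) = k (y, x)) ->
  measurable_fun setT u -> measurable_fun setT w -> (forall x, 0 <= w x) ->
  (forall z, 0 < k z ->
     Num.min (`|u z.1| `^ p) (`|u z.2| `^ p) <= w z.1 + w z.2) ->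
  let E := (\int[mu \x mu]_z (`|u z.1 - u z.2| `^ p * k z)%:E)%E in
  let G f := (\int[mu]_x ((f x)%:E * \int[mu]_y (k (x, y))%:E))%E in
  let g := fun x => `|u x| `^ p in
  (E <= (1 + e)%:E * (G g + G g) + C%:E * (G w + G w))%E /\
  ((1 - e)%:E * (G g + G g) <= E + C%:E * (G w + G w))%E.
Proof.
move=> p0 /andP[e0 e1] C0 HC mk k0 ksym mu_ mw w0 kw E G g.
have mg : measurable_fun setT g by exact: measurable_norm_powR.
have g0 x : 0 <= g x by exact: powR_ge0.
have me : measurable_fun setT (fun z : X * X => `|u z.1 - u z.2| `^ p * k z).
  exact: measurable_energy_integrand.
have msum (f : X -> R) : measurable_fun setT f ->
    measurable_fun setT (fun z : X * X => (f z.1 + f z.2) * k z).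
  move=> mf; apply: measurable_funM => //.
  by apply: measurable_funD; exact: measurableT_comp.
have sumE (f : X -> R) : measurable_fun setT f -> (forall x, 0 <= f x) ->
    (\int[mu \x mu]_z ((f z.1 + f z.2) * k z)%:E = G f + G f)%E.
  move=> mf f0; rewrite /G -[X in _ = (X + _)%E]integral_kernel_fst//.
  rewrite -[X in _ = (_ + X)%E]integral_kernel_snd//.
  rewrite -ge0_integralD//; last 4 first.
  - by move=> z _; rewrite lee_fin mulr_ge0.
  - apply/measurable_EFinP; apply: measurable_funM => //; exact: measurableT_comp.
  - by move=> z _; rewrite lee_fin mulr_ge0.
  - apply/measurable_EFinP; apply: measurable_funM => //; exact: measurableT_comp.
  by apply: eq_integral => z _; rewrite mulrDl EFinD.
have sumZ (f : X -> R) c : measurable_fun setT f -> (forall x, 0 <= f x) -> 0 <= c ->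
    (\int[mu \x mu]_z (c * ((f z.1 + f z.2) * k z))%:E = c%:E * (G f + G f))%E.
  move=> mf f0 c0; under eq_integral do rewrite EFinM.
  rewrite ge0_integralZl ?lee_fin ?sumE//.
  - by apply/measurable_EFinP; exact: msum.
  - by move=> z _; rewrite lee_fin mulr_ge0// addr_ge0.
have nn (f : X -> R) c z : (forall x, 0 <= f x) -> 0 <= c ->
    0 <= c * ((f z.1 + f z.2) * k z).
  by move=> f0 c0; rewrite !mulr_ge0// addr_ge0.
have mZ (f : X -> R) c : measurable_fun setT f ->
   measurable_fun setT (fun z : X * X => c * ((f z.1 + f z.2) * k z)).
  by move=> mf; apply: measurable_funM => //; exact: msum.
have Cmin z : C * Num.min (`|u z.1| `^ p) (`|u z.2| `^ p) * k z <=
    C * ((w z.1 + w z.2) * k z).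
  rewrite -mulrA ler_wpM2l//; have := k0 z; rewrite le_eqVlt.
  move=> /predU1P[<-|kz]; first by rewrite !mulr0.
  by rewrite ler_wpM2r// kw.
have e1' : 0 <= 1 + e by lra.
have e1'' : 0 <= 1 - e by lra.
split.
- rewrite -!sumZ// -ge0_integralD//; last 4 first.
  + by move=> z _; rewrite lee_fin nn.
  + by apply/measurable_EFinP; exact: mZ.
  + by move=> z _; rewrite lee_fin nn.
  + by apply/measurable_EFinP; exact: mZ.
  apply: ge0_le_integral => //.
  + by move=> z _; rewrite lee_fin mulr_ge0// powR_ge0.
  + exact/measurable_EFinP.
  + by apply: emeasurable_funD; apply/measurable_EFinP; exact: mZ.
  + move=> z _; rewrite -EFinD lee_fin.
    have [/(ler_wpM2r (k0 z)) + _] := HC (u z.1) (u z.2).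
    by have := Cmin z; rewrite /g; lra.
- rewrite -!sumZ// -ge0_integralD//; last 4 first.
  + by move=> z _; rewrite lee_fin mulr_ge0// powR_ge0.
  + exact/measurable_EFinP.
  + by move=> z _; rewrite lee_fin nn.
  + by apply/measurable_EFinP; exact: mZ.
  apply: ge0_le_integral => //.
  + by move=> z _; rewrite lee_fin nn.
  + by apply/measurable_EFinP; exact: mZ.
  + apply: emeasurable_funD; apply/measurable_EFinP => //; exact: mZ.
  + move=> z _; rewrite -EFinD lee_fin.
    have [_ /(ler_wpM2r (k0 z))] := HC (u z.1) (u z.2).
    by have := Cmin z; rewrite /g; lra.
Qed.

(** * Kernels extended by zero, and limits of integrals *)

(** Nothing is assumed of [rho] on the diagonal; extension by zero off a set [E] that avoids it
    yields a total nonnegative measurable function, ready for Tonelli. *)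
Definition kernel_on (R : realType) (X : Type) (E : set (X * X))
  (rho : X -> X -> R) : X * X -> R := fun z => if z \in E then rho z.1 z.2 else 0.

Lemma measurable_kernel_on (R : realType) (d : measure_display)
    (X : measurableType d) (E : set (X * X)) (rho : X -> X -> R) :
  measurable E -> measurable_fun E (fun z => rho z.1 z.2) ->
  measurable_fun setT (kernel_on E rho).
Proof.
move=> mE mrho; apply/measurable_EFinP.
rewrite (_ : _ \o _ = (fun z => (rho z.1 z.2)%:E) \_ E); last first.
  by apply/funext => z; rewrite patchE /kernel_on/=; case: ifPn.
by apply/(measurable_restrictT _ mE); exact/measurable_EFinP.
Qed.

Lemma kernel_on_ge0 (R : realType) (X : Type) (E : set (X * X))
    (rho : X -> X -> R) :
  (forall z, E z -> 0 <= rho z.1 z.2) -> forall z, 0 <= kernel_on E rho z.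
Proof.
by move=> rho0 z; rewrite /kernel_on; case: ifPn => // /[!inE]; exact: rho0.
Qed.

(** As a single product integral, an energy can be split along disjoint regions and compared
    pointwise. *)
Lemma energy_onE (R : realType) (d : measure_display) (X : measurableType d)
    (mu : {sigma_finite_measure set X -> \bar R}) (p : R) (D : X -> set X)
    (rho : X -> X -> R) (u : X -> R) (E : set (X * X)) :
  (forall x y, E (x, y) = D x y) -> measurable E ->
  measurable_fun E (fun z => rho z.1 z.2) ->
  (forall z, E z -> 0 <= rho z.1 z.2) -> measurable_fun setT u ->
  let k := kernel_on E rho in
  (energy_on mu p D rho u =
   \int[mu \x mu]_z (`|u z.1 - u z.2| `^ p * k z)%:E)%E.
Proof.
move=> ED mE mrho rho0 mu_ k.
have k0 z : 0 <= k z by exact: kernel_on_ge0.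
rewrite fubini_tonelli1; last 2 first.
- apply/measurable_EFinP; apply: measurable_energy_integrand => //.
  exact: measurable_kernel_on.
- by move=> z; rewrite lee_fin mulr_ge0// powR_ge0.
apply: eq_integral => x _; rewrite /fubini_F/= integral_mkcond.
apply: eq_integral => y _; rewrite /k /kernel_on patchE/=.
have -> : (y \in D x) = ((x, y) \in E).
  by apply/idP/idP; rewrite !inE ED.
by case: ifPn => //; rewrite mulr0.
Qed.

(* The limit [lim_k lim_n] of integrals, phrased as a double eventual statement
   so that it can be used for the two envelopes [esups] and [einfs] at once. *)
Lemma iterated_dominated_cvg (R : realType) (d : measure_display)
    (X : measurableType d) (mu : {measure set X -> \bar R}) (g : X -> R) (C L : R)
    (H : nat -> nat -> X -> \bar R) (S : nat -> X -> \bar R) :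
  measurable_fun setT g -> (forall x, 0 <= g x) ->
  (\int[mu]_x (g x)%:E < +oo)%E ->
  (forall n k, measurable_fun setT (H n k)) ->
  (forall n k x, 0 <= H n k x <= C%:E)%E ->
  (forall k x, H n k x @[n --> \oo] --> S k x) ->
  (forall x, S k x @[k --> \oo] --> L%:E) ->
  forall V, nbhs (L%:E * \int[mu]_x (g x)%:E)%E V ->
  \forall k \near \oo, \forall n \near \oo, V (\int[mu]_x ((g x)%:E * H n k x))%E.
Proof.
move=> mg g0 ig mH HC HS SL V nV.
have iCg : mu.-integrable setT (fun x => C%:E * (g x)%:E)%E.
  apply: integrableZl => //; apply/integrableP; split; first exact/measurable_EFinP.
  by under eq_integral do rewrite gee0_abs ?lee_fin//.
have bound (h : \bar R) x : (0 <= h <= C%:E -> `|(g x)%:E * h| <= C%:E * (g x)%:E)%E.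
  move=> /andP[h0 hC]; rewrite gee0_abs ?mule_ge0 ?lee_fin//.
  by rewrite muleC lee_wpmul2r ?lee_fin.
have mS k : measurable_fun setT (S k).
  by apply: (emeasurable_fun_cvg (fun n => H n k)) => // x _; exact: HS.
have SC k x : (0 <= S k x <= C%:E)%E.
  have cH : cvgn (fun n => H n k x) by apply/cvg_ex; exists (S k x); exact: HS.
  rewrite -(cvg_lim _ (HS k x))//; apply/andP; split.
    by apply: lime_ge => //; apply: nearW => n; case/andP: (HC n k x).
  by apply: lime_le => //; apply: nearW => n; case/andP: (HC n k x).
have cvg1 k : (\int[mu]_x ((g x)%:E * H n k x) @[n --> \oo] -->
    \int[mu]_x ((g x)%:E * S k x))%E.
  have [] := @dominated_convergence _ _ _ mu setT measurableT
    (fun n x => (g x)%:E * H n k x)%E (fun x => (g x)%:E * S k x)%E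
    (fun x => C%:E * (g x)%:E)%E => //.
  - by move=> n; apply: emeasurable_funM => //; exact/measurable_EFinP.
  - by apply: emeasurable_funM => //; exact/measurable_EFinP.
  - by apply: aeW => x _; apply: cvgeZl => //; exact: HS.
  - by apply: aeW => x n _; exact: bound.
have cvg2 : (\int[mu]_x ((g x)%:E * S k x) @[k --> \oo] -->
    L%:E * \int[mu]_x (g x)%:E)%E.
  have -> : (L%:E * \int[mu]_x (g x)%:E = \int[mu]_x ((g x)%:E * L%:E))%E.
    under [RHS]eq_integral do rewrite muleC.
    rewrite integralZl//; apply/integrableP; split; first exact/measurable_EFinP.
    by under eq_integral do rewrite gee0_abs ?lee_fin//.
  have [] := @dominated_convergence _ _ _ mu setT measurableT
    (fun n x => (g x)%:E * S n x)%E (fun x => (g x)%:E * L%:E)%E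
    (fun x => C%:E * (g x)%:E)%E => //.
  - by move=> n; apply: emeasurable_funM => //; exact/measurable_EFinP.
  - by apply: emeasurable_funM => //; exact/measurable_EFinP.
  - by apply: aeW => x _; apply: cvgeZl => //; exact: SL.
  - by apply: aeW => x n _; exact: bound.
(* With the interior, [V] is a neighbourhood of the inner limit itself for such [k], so the
   convergence in [n] can be applied to [V]. *)
have : \forall k \near \oo, (V^°) (\int[mu]_x ((g x)%:E * S k x))%E.
  exact: (cvg2 _ (nbhs_interior nV)).
by apply: filterS => k Vk; exact: (cvg1 k _ Vk).
Qed.

Lemma integral_outside_ball_cvg0 (R : realType) (d : measure_display)
    (X : measurableType d) (mu : {measure set X -> \bar R}) (g h : X -> R) :
  measurable_fun setT g -> (forall x, 0 <= g x) ->
  (\int[mu]_x (g x)%:E < +oo)%E -> measurable_fun setT h ->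
  (\int[mu]_x (if (j%:R <= h x)%R then g x else 0)%:E)%E @[j --> \oo] --> 0%E.
Proof.
move=> mg g0 ig mh.
have mif j : measurable_fun setT (fun x => if j%:R <= h x then g x else 0).
  by apply: measurable_fun_ifT => //; exact: measurable_fun_ler.
have [] := @dominated_convergence _ _ _ mu setT measurableT
  (fun j x => (if (j%:R <= h x)%R then g x else 0)%:E) (cst 0%E)
  (fun x => (g x)%:E) => //.
- by move=> j; exact/measurable_EFinP.
- apply: aeW => x _; apply: cvg_near_cst.
  near=> j; rewrite ifF//; apply/negbTE; rewrite -ltNge.
  by near: j; exact: nbhs_infty_gtr.
- apply/integrableP; split; first exact/measurable_EFinP.
  by under eq_integral do rewrite gee0_abs ?lee_fin//.
- apply: aeW => x j _; rewrite lee_fin; case: ifPn => _; first by rewrite ger0_norm.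
  by rewrite normr0.
by move=> _ _; rewrite integral0.
Unshelve. all: by end_near. Qed.

(** * The uniform estimate at large distance *)

(** The radius precedes the kernel in the quantifiers: this is the uniformity in [n] needed later.
    Only the bound [C1] on the mass of the kernel enters the choice of [r]. *)
Lemma far_energy_close (R : realType) (d : measure_display)
    (X : measurableType d) (mu : {sigma_finite_measure set X -> \bar R})
    (dist : X -> X -> R) (p C1 : R) (u : X -> R) :
  metric_measure_space dist mu -> 0 < p -> in_Lp mu p u -> 0 <= C1 ->
  forall eta : R, 0 < eta -> exists2 r : R, 0 < r &
  forall k : X * X -> R, measurable_fun setT k -> (forall z, 0 <= k z) ->
    (forall x y, k (x, y) = k (y, x)) ->
    (forall x, \int[mu]_y (k (x, y))%:E <= C1%:E)%E ->
    (forall z, 0 < k z -> r <= dist z.1 z.2) ->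
    let E := (\int[mu \x mu]_z (`|u z.1 - u z.2| `^ p * k z)%:E)%E in
    let G := (\int[mu]_x ((`|u x| `^ p)%:E * \int[mu]_y (k (x, y))%:E))%E in
    (E <= G + G + eta%:E)%E /\ (G + G <= E + eta%:E)%E.
Proof.
move=> mms p0 [mu_ uLp] C10 eta eta0.
pose g x := `|u x| `^ p.
have mg : measurable_fun setT g by exact: measurable_norm_powR.
have g0 x : 0 <= g x by exact: powR_ge0.
have [N N0 NE] : exists2 N : R, 0 <= N & (\int[mu]_x (g x)%:E = N%:E)%E.
  have ig0 : (0 <= \int[mu]_x (g x)%:E)%E by apply: integral_ge0 => x _; rewrite lee_fin.
  exists (fine (\int[mu]_x (g x)%:E)); first exact: fine_ge0.
  by rewrite fineK// ge0_fin_numE.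
have mdist := mms_measurable_dist mms.
case: mms => [[[d0 deq dC dtri] _ [s ds] _] _].
have M0 : 0 <= C1 * N by rewrite mulr_ge0.
(* Makes the multiplicative error [e * (2 * (C1 * N))] at most [eta / 2]; the summand [eta] keeps
   the denominator positive when [C1 * N] is 0, and [e] below 1. *)
pose e := eta / (4 * (C1 * N + eta)).
have den : 0 < 4 * (C1 * N + eta) by lra.
have e0 : 0 < e by rewrite divr_gt0.
have e1 : e < 1 by rewrite /e ltr_pdivrMr//; lra.
have eM : e * (2 * (C1 * N)) <= eta / 2.
  by rewrite /e mulrAC ler_pdivrMr//; nra.
have e01 : 0 < e < 1 by rewrite e0 e1.
have [C C0 HC] := powR_sub_close p0 e01.
have mh : measurable_fun setT (dist (s 0%N)).
  exact: (measurableT_comp mdist (measurable_pair1 (s 0%N))).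
have tl := integral_outside_ball_cvg0 mg g0 uLp mh.
pose w j x := if j%:R <= dist (s 0%N) x then g x else 0.
have [j [W [W0 WE CW]]] : exists j W, [/\ 0 <= W,
    (\int[mu]_x (w j x)%:E = W%:E)%E & C * (2 * (C1 * W)) <= eta / 2].
  (* An integral of [w j] at most [t] costs no more than the other [eta / 2]. As [C] depends on [e],
     the ball is chosen after [e]. *)
  pose t := eta / (4 * (C * C1 + 1)).
  have den1 : 0 < 4 * (C * C1 + 1).
    by rewrite mulr_gt0// ltr_wpDl// mulr_ge0.
  have t0 : 0 < t by rewrite divr_gt0.
  have /fine_cvgP[finW /cvgrPdist_lt /(_ _ t0) smallW] := tl.
  have [j [jf js]] := @filter_ex _ _ _ _ (filterI finW smallW).
  move: js; rewrite /= sub0r normrN => js.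
  have I0 : (0 <= \int[mu]_x (w j x)%:E)%E.
    by apply: integral_ge0 => x _; rewrite lee_fin /w; case: ifP.
  exists j, (fine (\int[mu]_x (w j x)%:E)%E); split; first exact: fine_ge0.
    by rewrite fineK.
  have {}js : fine (\int[mu]_x (w j x)%:E)%E <= t.
    by apply: le_trans (ler_norm _) (ltW js).
  have tE : t * (4 * (C * C1 + 1)) = eta by rewrite /t divfK// gt_eqF.
  have CC0 : 0 <= C * C1 by rewrite mulr_ge0.
  nra.
have mw : measurable_fun setT (w j).
  by apply: measurable_fun_ifT => //; exact: measurable_fun_ler.
have w0 x : 0 <= w j x by rewrite /w; case: ifP.
exists (2 * j%:R + 1); first by have := ler0n R j; lra.
move=> k mk k0 ksym kC kd E G.
have mass0 x : (0 <= \int[mu]_y (k (x, y))%:E)%E.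
  by apply: integral_ge0 => y _; rewrite lee_fin.
have mmass := measurable_kernel_mass mu mk k0.
(* points at distance at least 2j cannot both lie in the ball of radius j *)
have kw z : 0 < k z -> Num.min (`|u z.1| `^ p) (`|u z.2| `^ p) <= w j z.1 + w j z.2.
  move=> /kd dz; have := dtri z.1 (s 0%N) z.2; rewrite (dC z.1 (s 0%N)) => tri.
  have [h|h] := leP j%:R (dist (s 0%N) z.1).
    by rewrite {1}/w h ge_min; apply/orP; left; rewrite lerDl.
  have h2 : j%:R <= dist (s 0%N) z.2 by lra.
  by rewrite {2}/w h2 ge_min; apply/orP; right; rewrite lerDr.
have [up lo] := kernel_energy_close mu p0 e01 C0 HC mk k0 ksym mu_ mw w0 kw.
(* The mass bound makes these integrals real numbers, so that the error terms can be moved across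
   the inequalities. *)
have Gle (f : X -> R) Nf : measurable_fun setT f -> (forall x, 0 <= f x) ->
    (\int[mu]_x (f x)%:E = Nf%:E)%E ->
    exists2 x : R, (\int[mu]_x ((f x)%:E * \int[mu]_y (k (x, y))%:E) = x%:E)%E &
      0 <= x <= C1 * Nf.
  move=> mf f0 fN.
  have G0 : (0 <= \int[mu]_x ((f x)%:E * \int[mu]_y (k (x, y))%:E))%E.
    by apply: integral_ge0 => x _; rewrite mule_ge0 ?lee_fin.
  have GC : (\int[mu]_x ((f x)%:E * \int[mu]_y (k (x, y))%:E) <= (C1 * Nf)%:E)%E.
    rewrite EFinM -fN -ge0_integralZl ?lee_fin//; last 2 first.
    - exact/measurable_EFinP.
    - by move=> x _; rewrite lee_fin.
    apply: ge0_le_integral => //.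
    - by move=> x _; rewrite mule_ge0 ?lee_fin.
    - by apply: emeasurable_funM => //; exact/measurable_EFinP.
    - by apply: emeasurable_funM => //; exact/measurable_EFinP.
    - by move=> x _; rewrite muleC lee_wpmul2r ?lee_fin.
  have Gf : (\int[mu]_x ((f x)%:E * \int[mu]_y (k (x, y))%:E))%E \is a fin_num.
    by rewrite ge0_fin_numE// (le_lt_trans GC) ?ltry.
  exists (fine (\int[mu]_x ((f x)%:E * \int[mu]_y (k (x, y))%:E))%E).
    by rewrite fineK.
  by rewrite fine_ge0//= -lee_fin fineK.
have [a aE /andP[a0 aM]] := Gle _ _ mg g0 NE.
have [b bE /andP[b0 bM]] := Gle _ _ mw w0 WE.
have CW' : C * (b + b) <= eta / 2.
  by apply: le_trans CW; rewrite ler_wpM2l//; lra.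
have eM' : e * (a + a) <= eta / 2.
  by apply: le_trans eM; rewrite ler_wpM2l; lra.
move: up lo; rewrite /G aE bE -/E.
have E0 : (0 <= E)%E.
  by apply: integral_ge0 => z _; rewrite lee_fin mulr_ge0// powR_ge0.
case: E E0 => [z _|_|]; last by rewrite leeNy_eq.
  2: by rewrite -!EFinD leye_eq.
rewrite -!EFinD -!EFinM -?EFinD !lee_fin => up lo; split; lra.
Qed.

(** * Passage to the limit *)

Lemma ereal_cvg_sandwich (R : realType) (f : nat -> \bar R) (l : R) :
  (forall e : R, 0 < e ->
    \forall n \near \oo, ((l - e)%:E <= f n <= (l + e)%:E)%E) ->
  f n @[n --> \oo] --> l%:E.
Proof.
move=> H; apply/fine_cvgP; split.
  apply: filterS (H 1 ltr01) => n /andP[h1 h2]; rewrite fin_numE.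
  by apply/andP; split; apply/eqP => fE; move: h1 h2; rewrite fE.
apply/cvgrPdist_le => e e0; apply: filterS (H e e0) => n /=.
case: (f n) => [r| |]//=; rewrite ?lee_fin// => /andP[h1 h2].
  by rewrite ler_distl; apply/andP; split; lra.
by move: h2; rewrite leye_eq.
Qed.

Lemma tail_intE (R : realType) (d : measure_display) (X : measurableType d)
    (dist : X -> X -> R) (mu : {measure set X -> \bar R}) (rho : X -> X -> R)
    (x : X) (r : R) :
  (tail_int dist mu rho x r = \int[mu]_y
    (kernel_on [set z | r <= dist z.1 z.2]%R rho (x, y))%:E)%E.
Proof.
rewrite /tail_int integral_mkcond; apply: eq_integral => y _.
rewrite patchE /kernel_on/=.
have -> : (y \in [set y | r <= dist x y]) = ((x, y) \in [set z | r <= dist z.1 z.2]).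
  by apply/idP/idP; rewrite !inE.
by case: ifP.
Qed.

(** The theorem quantifies over a bare measure, while the Tonelli lemmas take a bundled sigma-finite
    one. An equality of measures allows the bundled one to be substituted everywhere. *)
Lemma sigma_finite_measure_pack (R : realType) (d : measure_display)
    (X : measurableType d) (mu : {measure set X -> \bar R}) :
  sigma_finite setT mu ->
  exists mu' : {sigma_finite_measure set X -> \bar R},
    mu = (mu' : {measure set X -> \bar R}).
Proof.
case: mu => m [m1 m2] /= H.
pose mu : {measure set X -> \bar R} := Measure.Pack (Measure.Class m2).
pose S := isSFinite.Build _ _ _ m (sfinite_measure_sigma_finite (mu := mu) H).
pose F := isSigmaFinite.Build _ _ _ m H.
by exists (HB.pack_for {sigma_finite_measure set X -> \bar R} m m1 m2 S F).
Qed.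

Lemma esups_einfs_bounds (R : realType) (f : nat -> \bar R) (C : R) :
  (forall n, 0 <= f n <= C%:E)%E ->
  forall n, [/\ (0 <= esups f n <= C%:E)%E, (0 <= einfs f n <= C%:E)%E,
    (f n <= esups f n)%E & (einfs f n <= f n)%E].
Proof.
move=> fC n.
have le1 : (f n <= esups f n)%E by apply: ereal_sup_ubound; exists n => /=.
have le2 : (einfs f n <= f n)%E by apply: ereal_inf_lbound; exists n => /=.
have [h1 h2] := andP (fC n).
have h3 : (esups f n <= C%:E)%E.
  by apply: ge_ereal_sup => _ [m _ <-]; case/andP: (fC m).
have h4 : (0 <= einfs f n)%E.
  by apply: le_ereal_inf_tmp => _ [m _ <-]; case/andP: (fC m).
split => //; first by rewrite h3 (le_trans h1).
by rewrite h4 (le_trans le2).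
Qed.

(** The near part keeps the form in which (B) speaks of it; the far part takes the form of
    [far_energy_close]. *)
Lemma energy_split (R : realType) (d : measure_display) (X : measurableType d)
    (dist : X -> X -> R) (mu : {sigma_finite_measure set X -> \bar R}) (p r : R)
    (rho : X -> X -> R) (u : X -> R) :
  metric_measure_space dist mu -> 0 < r ->
  (forall x y, x <> y -> 0 <= rho x y) ->
  measurable_fun [set xy : X * X | xy.1 <> xy.2] (fun xy => rho xy.1 xy.2) ->
  measurable_fun setT u ->
  (energy mu p rho u =
   energy_on mu p (fun x => [set y | 0 < dist x y < r]%R) rho u +
   \int[mu \x mu]_z (`|u z.1 - u z.2| `^ p *
     kernel_on [set z | r <= dist z.1 z.2]%R rho z)%:E)%E.
Proof.
move=> mms r0 rho0 mrho mu_.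
pose E0 := [set z : X * X | z.1 <> z.2].
pose E1 := [set z : X * X | 0 < dist z.1 z.2 < r].
pose E2 := [set z : X * X | r <= dist z.1 z.2].
have neqE := mms_dist_gt0 mms.
have m0 : measurable E0 by exact: mms_measurable_offdiag mms.
have m1 : measurable E1.
  have := mms_measurable_dist_itv `]0, r[ mms.
  by congr measurable; apply/seteqP; split => z /=; rewrite in_itv.
have m2 : measurable E2 by exact: mms_measurable_far mms.
have s1 : E1 `<=` E0 by move=> z /= /andP[/neqE].
have s2 : E2 `<=` E0 by move=> z /= h; apply/neqE; exact: lt_le_trans h.
have mr1 := measurable_funS m0 s1 mrho.
have mr2 := measurable_funS m0 s2 mrho.
rewrite /energy (@energy_onE _ _ _ _ _ _ _ _ E0)//; last 2 first.
- by move=> x y; apply/propext; split => h /esym.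
- by move=> z; exact: rho0.
rewrite (@energy_onE _ _ _ _ _ _ _ _ E1)//; last by move=> z /s1; exact: rho0.
have mD E : measurable E -> measurable_fun E (fun z : X * X => rho z.1 z.2) ->
    measurable_fun setT (fun z : X * X =>
      (`|u z.1 - u z.2| `^ p * kernel_on E rho z)%:E).
  move=> mE mrE; apply/measurable_EFinP; apply: measurable_energy_integrand => //.
  exact: measurable_kernel_on.
have nn E : E `<=` E0 -> forall z, setT z ->
    (0 <= (`|u z.1 - u z.2| `^ p * kernel_on E rho z)%:E)%E.
  move=> EE0 z _; rewrite lee_fin mulr_ge0 ?powR_ge0// kernel_on_ge0// => y.
  by move=> /EE0; exact: rho0.
rewrite -ge0_integralD//; first last.
- exact: mD.
- exact: nn.
- exact: mD.
- exact: nn.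
apply: eq_integral => z _; rewrite -EFinD -mulrDr; congr (_ * _)%:E.
rewrite /kernel_on.
have [z1|z1] := boolP (z \in E1).
  have -> : z \in E0 by rewrite inE; apply: s1; rewrite inE in z1.
  rewrite ifF ?addr0//; apply/negbTE; move: z1; rewrite notin_setE inE /E1 /=.
  by move=> /andP[_]; rewrite ltNge => /negP.
have [z2|z2] := boolP (z \in E2); rewrite add0r.
  by rewrite ifT// inE; apply: s2; rewrite inE in z2.
rewrite ifF//; apply/negbTE; rewrite notin_setE => /neqE h.
move: z1 z2; rewrite !notin_setE /E1 /E2 /= h/= => /negP.
by rewrite -leNgt.
Qed.

Unset Implicit Arguments.

Theorem mainTheorem1 (R : realType) (d : measure_display) (X : measurableType d)
  (dist : X -> X -> R) (mu : {measure set X -> \bar R}) (p : R)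
  (rho : nat -> X -> X -> R) (L : R) :
  metric_measure_space dist mu ->
  1 <= p ->
  (forall n x y, x <> y -> 0 <= rho n x y) ->
  (forall n x y, x <> y -> rho n x y = rho n y x) ->
  (forall n, measurable_fun [set xy : X * X | xy.1 <> xy.2]
                (fun xy => rho n xy.1 xy.2)) ->
  (* (A) *)
  0 <= L ->
  (forall x,
     (limn_esup (fun n => tail_int dist mu (rho n) x r)) @[r --> +oo] --> L%:E /\
     (limn_einf (fun n => tail_int dist mu (rho n) x r)) @[r --> +oo] --> L%:E) ->
  (* (B) *)
  (forall u, in_Lp mu p u ->
     (exists n0, (energy mu p (rho n0) u < +oo)%E) ->
     forall r : R, 0 < r ->
       energy_on mu p (fun x => [set y | 0 < dist x y < r]) (rho n) u @[n --> \oo]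
         --> 0%E) ->
  (* (C) *)
  (exists R0 : R, forall r : R, R0 <= r -> 0 < r ->
     exists C : R, forall x n, (tail_int dist mu (rho n) x r <= C%:E)%E) ->
  forall u, in_Lp mu p u ->
    (exists n0, (energy mu p (rho n0) u < +oo)%E) ->
    energy mu p (rho n) u @[n --> \oo] --> ((2 * L)%:E * Lp_norm_pow mu p u)%E.
Proof.
move=> mms p1 rho0 rhoC mrho L0 hA hB [R0 hC] u uLp en0.
have [mu' ?] := sigma_finite_measure_pack (mms_sigma_finite mms).
subst mu.
have p0 : 0 < p by lra.
have [[[d0 deq dC dtri] _ _ _] _] := mms.
pose r1 := Num.max R0 1.
have r10 : 0 < r1 by rewrite lt_max ltr01 orbT.
have [C' hC'] := hC r1 (ltac:(by rewrite le_max lexx)) r10.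
pose C := Num.max C' 0.
have C0 : 0 <= C by rewrite le_max lexx orbT.
(* A sequence of radii replaces the real limit in (A), as dominated convergence is sequential. It
   starts at [r1], where (C) supplies [C]. *)
pose r k := r1 + k%:R : R.
have r0 k : 0 < r k by rewrite ltr_pwDl.
pose K n k := kernel_on [set z | r k <= dist z.1 z.2] (rho n).
have Kne k (z : X * X) : r k <= dist z.1 z.2 -> z.1 <> z.2.
  by move=> h /deq zz; move: h; rewrite zz leNgt r0.
have mE k := mms_measurable_far (r k) mms.
have mE0 := mms_measurable_offdiag mms.
have mK n k : measurable_fun setT (K n k).
  apply: measurable_kernel_on => //; apply: measurable_funS (mrho n) => //.
  by move=> z /=; exact: Kne.
have K0 n k z : 0 <= K n k z.
  by apply: kernel_on_ge0 => z' /= h; apply/rho0/(Kne k).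
have Ksym n k x y : K n k (x, y) = K n k (y, x).
  rewrite /K /kernel_on/=.
  have -> : ((x, y) \in [set z | r k <= dist z.1 z.2]) =
            ((y, x) \in [set z | r k <= dist z.1 z.2]).
    by apply/idP/idP; rewrite !inE/= dC.
  by case: ifP => //; rewrite inE /= => /(Kne k (y, x)) yx; rewrite rhoC// => /esym.
pose T n k x := (\int[mu']_y (K n k (x, y))%:E)%E.
have TE n k x : T n k x = tail_int dist mu' (rho n) x (r k) by rewrite tail_intE.
have mT n k : measurable_fun setT (T n k) by exact: measurable_kernel_mass.
have T0 n k x : (0 <= T n k x)%E by apply: integral_ge0 => y _; rewrite lee_fin.
(* Tail masses decrease with the radius, so the constant of (C) at [r 0] serves for all [k]. *)
have TC n k x : (0 <= T n k x <= C%:E)%E.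
  rewrite T0/=; apply: (@le_trans _ _ (T n 0%N x)); last first.
    rewrite TE /r addr0; apply: le_trans (hC' x n) _.
    by rewrite lee_fin le_max lexx.
  apply: ge0_le_integral => //.
  - by move=> y _; rewrite lee_fin.
  - by apply/measurable_EFinP; apply: measurableT_comp.
  - by apply/measurable_EFinP; apply: measurableT_comp.
  - move=> y _; rewrite lee_fin {1}/K /kernel_on; case: ifPn => // /[!inE] /= h.
    rewrite /K /kernel_on ifT// inE /= (le_trans _ h)// /r addr0.
    by rewrite lerDl.
have rk : r k @[k --> \oo] --> +oo.
  apply/cvgryPge => A; near=> k; rewrite /r (@le_trans _ _ k%:R)//; last first.
    by rewrite lerDr ltW.
  by near: k; exact: nbhs_infty_ger.
have Asup x : limn_esup (fun n => T n k x) @[k --> \oo] --> L%:E.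
  have := cvg_comp _ _ rk (hA x).1; apply: cvg_trans; apply: near_eq_cvg.
  by apply: nearW => k /=; congr limn_esup; apply/funext => n; rewrite TE.
have Ainf x : limn_einf (fun n => T n k x) @[k --> \oo] --> L%:E.
  have := cvg_comp _ _ rk (hA x).2; apply: cvg_trans; apply: near_eq_cvg.
  by apply: nearW => k /=; congr limn_einf; apply/funext => n; rewrite TE.
pose g x := `|u x| `^ p.
have [mu_ ig] := uLp.
have mg : measurable_fun setT g by exact: measurable_norm_powR.
have g0 x : 0 <= g x by exact: powR_ge0.
have [N NE] : exists N : R, (\int[mu']_x (g x)%:E = N%:E)%E.
  have ig0 : (0 <= \int[mu']_x (g x)%:E)%E by apply: integral_ge0 => x _; rewrite lee_fin.
  exists (fine (\int[mu']_x (g x)%:E)).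
  by rewrite fineK// ge0_fin_numE.
rewrite /Lp_norm_pow [X in (_ * X)%E]NE -EFinM; apply: ereal_cvg_sandwich => e e0.
(* Four errors share [e]: one for each of the two copies of [G], one for the far estimate and one
   for the near energy. *)
have e40 : 0 < e / 4 by rewrite divr_gt0.
have nV : nbhs (L%:E * \int[mu']_x (g x)%:E)%E
    [set y | ((L * N - e / 4)%:E <= y <= (L * N + e / 4)%:E)%E].
  rewrite NE -EFinM; apply/nbhs_EFin; near=> y; rewrite /= !lee_fin -ler_distlC.
  by near: y; apply: cvgr_dist_le => //; exact: cvg_id.
have bnd k x := esups_einfs_bounds (fun m => TC m k x).
have cvgsup k x : esups (fun m => T m k x) n @[n --> \oo] -->
    limn_esup (fun n => T n k x) by rewrite limn_esup_lim; exact: is_cvg_esups.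
have cvginf k x : einfs (fun m => T m k x) n @[n --> \oo] -->
    limn_einf (fun n => T n k x) by rewrite limn_einf_lim; exact: is_cvg_einfs.
have up := @iterated_dominated_cvg _ _ _ mu' g C L
  (fun n k x => esups (fun m => T m k x) n) (fun k x => limn_esup (fun n => T n k x))
  mg g0 ig (fun n k => measurable_fun_esups (fun m => mT m k) n)
  (fun n k x => let: And4 h _ _ _ := bnd k x n in h)
  cvgsup Asup _ nV.
have lo := @iterated_dominated_cvg _ _ _ mu' g C L
  (fun n k x => einfs (fun m => T m k x) n) (fun k x => limn_einf (fun n => T n k x))
  mg g0 ig (fun n k => measurable_fun_einfs (fun m => mT m k) n)
  (fun n k x => let: And4 _ h _ _ := bnd k x n in h)
  cvginf Ainf _ nV.
have [rf rf0 far] := far_energy_close mms p0 uLp C0 e40.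
have rfk : \forall k \near \oo, rf <= r k by move/cvgryPge: rk; exact.
(* A single [k] suits both envelopes and the far estimate. It is fixed before [n], and (B) is then
   applied at the radius [r k]. *)
have [k [[upk lok] rfk']] := @filter_ex _ _ _ _ (filterI (filterI up lo) rfk).
have /fine_cvgP[finB /cvgrPdist_le /(_ _ e40) smallB] := hB u uLp en0 (r k) (r0 k).
near=> n.
have /andP[_ up1] : ((L * N - e / 4)%:E <=
    \int[mu']_x ((g x)%:E * esups (fun m => T m k x) n) <= (L * N + e / 4)%:E)%E.
  by near: n; exact: upk.
have /andP[lo1 _] : ((L * N - e / 4)%:E <=
    \int[mu']_x ((g x)%:E * einfs (fun m => T m k x) n) <= (L * N + e / 4)%:E)%E.
  by near: n; exact: lok.
pose G := (\int[mu']_x ((g x)%:E * T n k x))%E.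
have mgT (f : X -> \bar R) : measurable_fun setT f ->
    measurable_fun setT (fun x => (g x)%:E * f x)%E.
  by move=> mf; apply: emeasurable_funM => //; exact/measurable_EFinP.
have Gup : (G <= (L * N + e / 4)%:E)%E.
  apply: le_trans up1; apply: ge0_le_integral => //.
  - by move=> x _; rewrite mule_ge0 ?lee_fin.
  - exact: mgT.
  - by apply: mgT; exact: measurable_fun_esups.
  - move=> x _; rewrite lee_wpmul2l ?lee_fin//.
    by case: (bnd k x n).
have Glo : ((L * N - e / 4)%:E <= G)%E.
  apply: (le_trans lo1); apply: ge0_le_integral => //.
  - move=> x _; rewrite mule_ge0 ?lee_fin//.
    by case: (bnd k x n) => _ /andP[].
  - by apply: mgT; exact: measurable_fun_einfs.
  - exact: mgT.
  - move=> x _; rewrite lee_wpmul2l ?lee_fin//.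
    by case: (bnd k x n).
have [] := far (K n k) (mK n k) (K0 n k) (Ksym n k) _ _.
- by move=> x; case/andP: (TC n k x).
- move=> z; rewrite /K /kernel_on; case: ifPn; last by rewrite ltxx.
  by rewrite inE /= => h _; exact: le_trans h.
rewrite -/G (energy_split p mms (r0 k))//; last exact: rho0.
have fB : energy_on mu' p (fun x => [set y | 0 < dist x y < r k]) (rho n) u \is a fin_num.
  by near: n.
have sB : `|0 - fine (energy_on mu' p (fun x => [set y | 0 < dist x y < r k]) (rho n) u)|
   <= e / 4 by near: n.
rewrite -(fineK fB).
move: (fine _) sB => b; rewrite sub0r normrN ler_norml => /andP[b1 b2].
move: (integral _ _ _) => F.
(* [G] lies between two reals and [F] is within [e / 4] of [G + G]; the infinite cases are thus
   contradictory and linear arithmetic remains. *)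
move: G Gup Glo => [G| |]; rewrite ?leye_eq ?leeNy_eq// !lee_fin => Gup Glo.
move: F => [F| |]; rewrite -?EFinD ?leye_eq ?leeNy_eq// ?addNye ?leeNy_eq//.
rewrite !lee_fin => h1 h2; apply/andP; split; lra.
Unshelve. all: by end_near. Qed.
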